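(* Let $r$ be a real number with $r < 0$. Then for all complex numbers $A, B \in \mathbb{C}$: $A \leq B$ if and only if $rA \geq rB$. In particular, $A \leq B$ if and only if $-A \geq -B$.
   Context: The relations $\leq$ and $\geq$ on $\mathbb{C}$ are defined as follows. Write $A = a_1 + a_2 i$, $B = b_1 + b_2 i$ with $a_1,a_2,b_1,b_2 \in \mathbb{R}$. Then $A \leq B$ means: $a_1 < b_1$, or ($a_1 = b_1$ and $a_2 \leq b_2$). And $A \geq B$ means: $a_1 > b_1$, or ($a_1 = b_1$ and $a_2 \geq b_2$). *)

(* Defs.v *)
(* Stdlib reals, with Coquelicot's complex numbers [C]. *)
From Stdlib Require Import Reals.
From Coquelicot Require Import Coquelicot.

Definition Cle (A B : C) : Prop :=
  (Re A < Re B)%R \/ (Re A = Re B /\ (Im A <= Im B)%R).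

Definition Cge (A B : C) : Prop :=
  (Re A > Re B)%R \/ (Re A = Re B /\ (Im A >= Im B)%R).

Notation "A <= B" := (Cle A B) : C_scope.
Notation "A >= B" := (Cge A B) : C_scope.

(* Main.v *)
Require Import Defs.
From Stdlib Require Import Reals Lra.
From Coquelicot Require Import Coquelicot.

(** The order on the complex numbers is the lexicographic order of the pair
    (real part, imaginary part), and a real factor [r] acts on that pair
    coordinatewise ([Re_scal], [Im_scal]).  Multiplication by [r < 0] reverses
    the order of the reals in each coordinate and preserves equality, being
    injective; both directions of each equivalence hold because division by
    [r] is again multiplication by a negative number.  Hence each clause of
    the lexicographic comparison is carried to the corresponding clause of the
    reversed one.  The case of the opposite is [r = -1]. *)

Lemma Re_scal (r : R) (A : C) : Re (RtoC r * A)%C = (r * Re A)%R.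
Proof. destruct A; simpl; ring. Qed.

Lemma Im_scal (r : R) (A : C) : Im (RtoC r * A)%C = (r * Im A)%R.
Proof. destruct A; simpl; ring. Qed.

Lemma Rmult_lt_neg_iff (r x y : R) :
  (r < 0)%R -> (x < y)%R <-> (r * x > r * y)%R.
Proof.
intros Hr; split; intros H.
- now apply Rmult_lt_gt_compat_neg_l.
- apply (Rmult_lt_reg_l (- r)); lra.
Qed.

Lemma Rmult_eq_neg_iff (r x y : R) :
  (r < 0)%R -> x = y <-> (r * x = r * y)%R.
Proof.
intros Hr; split; intros H.
- now rewrite H.
- apply (Rmult_eq_reg_l r); lra.
Qed.

Lemma Rmult_le_neg_iff (r x y : R) :
  (r < 0)%R -> (x <= y)%R <-> (r * x >= r * y)%R.
Proof.
intros Hr; unfold Rle, Rge.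
rewrite (Rmult_lt_neg_iff r x y Hr), (Rmult_eq_neg_iff r x y Hr).
reflexivity.
Qed.

Lemma Cle_scal_neg (r : R) (A B : C) :
  (r < 0)%R -> (A <= B)%C <-> (RtoC r * A >= RtoC r * B)%C.
Proof.
intros Hr; unfold Cle, Cge; rewrite !Re_scal, !Im_scal.
rewrite (Rmult_lt_neg_iff r _ _ Hr), (Rmult_eq_neg_iff r _ _ Hr),
  (Rmult_le_neg_iff r _ _ Hr).
reflexivity.
Qed.

Lemma Copp_scal (A : C) : (- A)%C = (RtoC (-1) * A)%C.
Proof. destruct A; apply injective_projections; simpl; ring. Qed.

Theorem theorem5 :
  (forall r : R, (r < 0)%R ->
     forall A B : C, (A <= B)%C <-> (RtoC r * A >= RtoC r * B)%C) /\
  (forall A B : C, (A <= B)%C <-> (- A >= - B)%C).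
Proof.
split.
- intros r Hr A B; now apply Cle_scal_neg.
- intros A B; rewrite (Copp_scal A), (Copp_scal B).
  apply Cle_scal_neg; lra.
Qed.
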